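(* Let $\mathscr{C}$ be a left skew monoidal category and $\mathscr{A}$ a left skew $\mathscr{C}$-actegory. Suppose $(T,K,v,v_0,k)$ is a skew left warping riding the skew action of $\mathscr{C}$ on $\mathscr{A}$. Suppose $(\mathscr{A}, G,\gamma , \delta, \epsilon)$ is a comonad in the 2-category $\mathrm{Cat}^{\mathscr{C}}$ for which all morphisms of the form $\gamma_{TA,K}$ and $\gamma_{TA,TB\star K}$ ($A,B\in\mathscr{A}$) are invertible. Let $\mathrm{U}:\mathscr{A}^G\to\mathscr{A}$, $(A,a)\mapsto A$, be the underlying functor. Then $(T\mathrm{U},(GK,\delta_K),v,v'_0,k')$ is a skew left warping riding the left skew $\mathscr{C}$-actegory $\mathscr{A}^G$, whose action is $$X\star(A,a)=(X\star A,\ \gamma_{X,A}\circ(1_X\star a)),$$ with $\alpha,\lambda$ as in $\mathscr{A}$. Here $v$ has components $v_{(A,a),(B,b)}=v_{A,B}$, $v'_0=v_0\circ T\epsilon_K: TGK\to I$, and $$k'_{(A,a)} = \gamma^{-1}_{TA,K}\circ Gk_A\circ a : (A,a)\to TA\star(GK,\delta_K).$$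
   Context: A left skew monoidal category $\mathscr{C}$ is a category with a functor $\otimes : \mathscr{C} \times \mathscr{C} \to \mathscr{C}$, an object $I$, and natural (not necessarily invertible) morphisms $\alpha_{X,Y,Z} : (X\otimes Y)\otimes Z \to X\otimes (Y\otimes Z)$, $\lambda_X : I\otimes X \to X$, $\rho_X : X\to X\otimes I$, satisfying: $(1_W\otimes\alpha_{X,Y,Z})\alpha_{W,X\otimes Y,Z}(\alpha_{W,X,Y}\otimes 1_Z)=\alpha_{W,X,Y\otimes Z}\,\alpha_{W\otimes X,Y,Z}$; $\lambda_{X\otimes Y}\alpha_{I,X,Y}=\lambda_X\otimes 1_Y$; $(1_X\otimes\lambda_Y)\alpha_{X,I,Y}(\rho_X\otimes 1_Y)=1_{X\otimes Y}$; $\alpha_{X,Y,I}\rho_{X\otimes Y}=1_X\otimes\rho_Y$; $\lambda_I\rho_I=1_I$. A left skew action of $\mathscr{C}$ on a category $\mathscr{A}$ (making $\mathscr{A}$ a left skew $\mathscr{C}$-actegory) is a functor $\star:\mathscr{C}\times\mathscr{A}\to\mathscr{A}$ with natural families $\alpha_{X,Y,A}:(X\otimes Y)\star A\to X\star(Y\star A)$ and $\lambda_A:I\star A\to A$ such that $\alpha_{X,Y,Z\star A}\,\alpha_{X\otimes Y,Z,A}=(1_X\star\alpha_{Y,Z,A})\,\alpha_{X,Y\otimes Z,A}\,(\alpha_{X,Y,Z}\star 1_A)$; $\lambda_{Y\star A}\,\alpha_{I,Y,A}=\lambda_Y\star 1_A$; $(1_X\star\lambda_A)\,\alpha_{X,I,A}\,(\rho_X\star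 1_A)=1_{X\star A}$. A skew left warping $(T,K,v,v_0,k)$ riding the skew action of $\mathscr{C}$ on $\mathscr{A}$ consists of: a functor $T:\mathscr{A}\to\mathscr{C}$; an object $K\in\mathscr{A}$; a natural family $v_{A,B}:T(TA\star B)\to TA\otimes TB$ in $\mathscr{C}$; a morphism $v_0:TK\to I$; and a natural family $k_A:A\to TA\star K$; such that (W1) $\alpha_{TA,TB,TC}\,(v_{A,B}\otimes 1_{TC})\,v_{TA\star B,C}=(1_{TA}\otimes v_{B,C})\,v_{A,TB\star C}\,T(\alpha_{TA,TB,C})\,T(v_{A,B}\star 1_C)$; (W2) $\lambda_{TB}\,(v_0\otimes 1_{TB})\,v_{K,B}=T(\lambda_B)\,T(v_0\star 1_B)$; (W3) $(1_{TA}\otimes v_0)\,v_{A,K}\,T(k_A)=\rho_{TA}$; (W4) $\alpha_{TA,TB,K}\,(v_{A,B}\star 1_K)\,k_{TA\star B}=1_{TA}\star k_B$; (W5) $\lambda_K\,(v_0\star 1_K)\,k_K=1_K$. The 2-category $\mathrm{Cat}^{\mathscr{C}}$ has left skew $\mathscr{C}$-actegories as objects; a morphism $(F,\gamma):\mathscr{A}\to\mathscr{B}$ is a functor $F$ with a natural family $\gamma_{X,A}:X\star FA\to F(X\star A)$ such that $F(\alpha_{X,Y,A})\,\gamma_{X\otimes Y,A}=\gamma_{X,Y\star A}\,(1_X\star\gamma_{Y,A})\,\alpha_{X,Y,FA}$ and $F(\lambda_A)\,\gamma_{I,A}=\lambda_{FA}$; a 2-cell $\xi:(F,\gamma)\Rightarrow(F',\gamma')$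 is a natural transformation with $\xi_{X\star A}\,\gamma_{X,A}=\gamma'_{X,A}\,(1_X\star\xi_A)$. Thus a comonad $(\mathscr{A},G,\gamma,\delta,\epsilon)$ in $\mathrm{Cat}^{\mathscr{C}}$ is a left skew $\mathscr{C}$-actegory $\mathscr{A}$, a comonad $(G,\delta,\epsilon)$ on the category $\mathscr{A}$, and a natural family $\gamma_{X,A}:X\star GA\to G(X\star A)$ making $(G,\gamma)$ a morphism in $\mathrm{Cat}^{\mathscr{C}}$ and satisfying $\delta_{X\star A}\,\gamma_{X,A}=G(\gamma_{X,A})\,\gamma_{X,GA}\,(1_X\star\delta_A)$ and $\epsilon_{X\star A}\,\gamma_{X,A}=1_X\star\epsilon_A$. $\mathscr{A}^G$ is the category of Eilenberg-Moore coalgebras $(A,a:A\to GA)$ of $(G,\delta,\epsilon)$; the action displayed in the claim makes it a left skew $\mathscr{C}$-actegory. *)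

(* Defs.v *)
From Stdlib Require Import ProofIrrelevance.

Declare Scope cat_scope.
Delimit Scope cat_scope with cat.
Open Scope cat_scope.

Reserved Notation "g ∘ f" (at level 40, left associativity).
Reserved Notation "X ⊗ Y" (at level 34, left associativity).
Reserved Notation "f ⊗ₘ g" (at level 34, left associativity).
Reserved Notation "X ⋆ A" (at level 34, left associativity).
Reserved Notation "f ⋆ₘ g" (at level 34, left associativity).

Record Category := {
  Obj :> Type;
  Hom : Obj -> Obj -> Type;
  idm : forall X, Hom X X;
  comp : forall X Y Z, Hom Y Z -> Hom X Y -> Hom X Z;
  comp_id_l : forall X Y (f : Hom X Y), comp X Y Y (idm Y) f = f;
  comp_id_r : forall X Y (f : Hom X Y), comp X X Y f (idm X) = f;
  comp_assoc : forall W X Y Z (h : Hom Y Z) (g : Hom X Y) (f : Hom W X),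
    comp W Y Z h (comp W X Y g f) = comp W X Z (comp X Y Z h g) f
}.
Arguments Hom {c} X Y.
Arguments idm {c} X.
Arguments comp {c X Y Z} g f : rename.
Arguments comp_id_l {c X Y} f.
Arguments comp_id_r {c X Y} f.
Arguments comp_assoc {c W X Y Z} h g f.
Notation "g ∘ f" := (comp g f) : cat_scope.

(* The inverse is carried as data so that it can be named in statements; it is
   unique whenever it exists. *)
Record Invertible {C : Category} {X Y : C} (f : Hom X Y) := {
  inv : Hom Y X;
  inv_l : inv ∘ f = idm X;
  inv_r : f ∘ inv = idm Y
}.
Arguments inv {C X Y f} i.
Arguments inv_l {C X Y f} i.
Arguments inv_r {C X Y f} i.

Record Functor (C D : Category) := {
  fobj :> C -> D;
  fmap : forall X Y : C, Hom X Y -> Hom (fobj X) (fobj Y);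
  fmap_id : forall X : C, fmap X X (idm X) = idm (fobj X);
  fmap_comp : forall (X Y Z : C) (g : Hom Y Z) (f : Hom X Y),
    fmap X Z (g ∘ f) = fmap Y Z g ∘ fmap X Y f
}.
Arguments fobj {C D} F X : rename.
Arguments fmap {C D} F {X Y} f : rename.
Arguments fmap_id {C D} F X : rename.
Arguments fmap_comp {C D} F {X Y Z} g f : rename.

Definition comp_functor {C D E : Category} (F : Functor D E) (F' : Functor C D) :
  Functor C E.
Proof.
refine {| fobj := fun X => F (F' X); fmap := fun X Y f => fmap F (fmap F' f) |}.
- abstract (intros X; now rewrite !fmap_id).
- abstract (intros X Y Z g f; now rewrite !fmap_comp).
Defined.

Definition prod_cat (C D : Category) : Category.
Proof.
refine {| Obj := (Obj C * Obj D)%type;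
          Hom := fun p q => (Hom (fst p) (fst q) * Hom (snd p) (snd q))%type;
          idm := fun p => (idm (fst p), idm (snd p));
          comp := fun p q r g f => (fst g ∘ fst f, snd g ∘ snd f) |}.
- abstract (intros p q [f g]; cbn; now rewrite !comp_id_l).
- abstract (intros p q [f g]; cbn; now rewrite !comp_id_r).
- abstract (intros p q r s h g f; cbn; now rewrite !comp_assoc).
Defined.

Definition bimap {C D E : Category} (F : Functor (prod_cat C D) E)
    {X X' : C} {Y Y' : D} (f : Hom X X') (g : Hom Y Y') :
    Hom (F (X, Y)) (F (X', Y')) :=
  @fmap (prod_cat C D) E F (X, Y) (X', Y') (f, g).

Record SkewMonoidalCategory := {
  smc_cat :> Category;
  tensor : Functor (prod_cat smc_cat smc_cat) smc_cat
    where "X ⊗ Y" := (fobj tensor (X, Y))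
    and "f ⊗ₘ g" := (bimap tensor f g);
  munit : smc_cat;
  assoc : forall X Y Z : smc_cat, Hom ((X ⊗ Y) ⊗ Z) (X ⊗ (Y ⊗ Z));
  lunit : forall X : smc_cat, Hom (munit ⊗ X) X;
  runit : forall X : smc_cat, Hom X (X ⊗ munit);
  assoc_natural : forall (X X' Y Y' Z Z' : smc_cat)
      (f : Hom X X') (g : Hom Y Y') (h : Hom Z Z'),
    assoc X' Y' Z' ∘ ((f ⊗ₘ g) ⊗ₘ h) = (f ⊗ₘ (g ⊗ₘ h)) ∘ assoc X Y Z;
  lunit_natural : forall (X X' : smc_cat) (f : Hom X X'),
    lunit X' ∘ (idm munit ⊗ₘ f) = f ∘ lunit X;
  runit_natural : forall (X X' : smc_cat) (f : Hom X X'),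
    runit X' ∘ f = (f ⊗ₘ idm munit) ∘ runit X;
  smc_pentagon : forall W X Y Z : smc_cat,
    (idm W ⊗ₘ assoc X Y Z) ∘ assoc W (X ⊗ Y) Z ∘ (assoc W X Y ⊗ₘ idm Z)
    = assoc W X (Y ⊗ Z) ∘ assoc (W ⊗ X) Y Z;
  smc_lunit_assoc : forall X Y : smc_cat,
    lunit (X ⊗ Y) ∘ assoc munit X Y = lunit X ⊗ₘ idm Y;
  smc_triangle : forall X Y : smc_cat,
    (idm X ⊗ₘ lunit Y) ∘ assoc X munit Y ∘ (runit X ⊗ₘ idm Y) = idm (X ⊗ Y);
  smc_assoc_runit : forall X Y : smc_cat,
    assoc X Y munit ∘ runit (X ⊗ Y) = idm X ⊗ₘ runit Y;
  smc_lunit_runit : lunit munit ∘ runit munit = idm munit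
}.
Arguments tensor {s}.
Arguments munit {s}.
Arguments assoc {s} X Y Z.
Arguments lunit {s} X.
Arguments runit {s} X.
Notation "X ⊗ Y" := (fobj tensor (X, Y)) : cat_scope.
Notation "f ⊗ₘ g" := (bimap tensor f g) : cat_scope.

Record SkewActegory (C : SkewMonoidalCategory) := {
  act_cat :> Category;
  action : Functor (prod_cat C act_cat) act_cat
    where "X ⋆ A" := (fobj action (X, A))
    and "f ⋆ₘ g" := (bimap action f g);
  act_assoc : forall (X Y : C) (A : act_cat), Hom ((X ⊗ Y) ⋆ A) (X ⋆ (Y ⋆ A));
  act_lunit : forall A : act_cat, Hom (munit ⋆ A) A;
  act_assoc_natural : forall (X X' Y Y' : C) (A A' : act_cat)
      (f : Hom X X') (g : Hom Y Y') (h : Hom A A'),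
    act_assoc X' Y' A' ∘ ((f ⊗ₘ g) ⋆ₘ h) = (f ⋆ₘ (g ⋆ₘ h)) ∘ act_assoc X Y A;
  act_lunit_natural : forall (A A' : act_cat) (f : Hom A A'),
    act_lunit A' ∘ (idm munit ⋆ₘ f) = f ∘ act_lunit A;
  act_pentagon : forall (X Y Z : C) (A : act_cat),
    act_assoc X Y (Z ⋆ A) ∘ act_assoc (X ⊗ Y) Z A
    = (idm X ⋆ₘ act_assoc Y Z A) ∘ act_assoc X (Y ⊗ Z) A
      ∘ (assoc X Y Z ⋆ₘ idm A);
  act_lunit_assoc : forall (Y : C) (A : act_cat),
    act_lunit (Y ⋆ A) ∘ act_assoc munit Y A = lunit Y ⋆ₘ idm A;
  act_triangle : forall (X : C) (A : act_cat),
    (idm X ⋆ₘ act_lunit A) ∘ act_assoc X munit A ∘ (runit X ⋆ₘ idm A)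
    = idm (X ⋆ A)
}.
Arguments action {C s}.
Arguments act_assoc {C s} X Y A.
Arguments act_lunit {C s} A.
Notation "X ⋆ A" := (fobj action (X, A)) : cat_scope.
Notation "f ⋆ₘ g" := (bimap action f g) : cat_scope.

Record IsSkewLeftWarping {C : SkewMonoidalCategory} (A : SkewActegory C)
    (T : Functor A C) (K : A)
    (v : forall X Y : A, Hom (T (T X ⋆ Y)) (T X ⊗ T Y))
    (v0 : Hom (T K) munit)
    (k : forall X : A, Hom X (T X ⋆ K)) : Prop := {
  warp_v_natural : forall (X X' Y Y' : A) (f : Hom X X') (g : Hom Y Y'),
    v X' Y' ∘ fmap T (fmap T f ⋆ₘ g) = (fmap T f ⊗ₘ fmap T g) ∘ v X Y;
  warp_k_natural : forall (X X' : A) (f : Hom X X'),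
    k X' ∘ f = (fmap T f ⋆ₘ idm K) ∘ k X;
  warp_W1 : forall X Y Z : A,
    assoc (T X) (T Y) (T Z) ∘ (v X Y ⊗ₘ idm (T Z)) ∘ v (T X ⋆ Y) Z
    = (idm (T X) ⊗ₘ v Y Z) ∘ v X (T Y ⋆ Z) ∘ fmap T (act_assoc (T X) (T Y) Z)
      ∘ fmap T (v X Y ⋆ₘ idm Z);
  warp_W2 : forall Y : A,
    lunit (T Y) ∘ (v0 ⊗ₘ idm (T Y)) ∘ v K Y
    = fmap T (act_lunit Y) ∘ fmap T (v0 ⋆ₘ idm Y);
  warp_W3 : forall X : A,
    (idm (T X) ⊗ₘ v0) ∘ v X K ∘ fmap T (k X) = runit (T X);
  warp_W4 : forall X Y : A,
    act_assoc (T X) (T Y) K ∘ (v X Y ⋆ₘ idm K) ∘ k (T X ⋆ Y)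
    = idm (T X) ⋆ₘ k Y;
  warp_W5 : act_lunit K ∘ (v0 ⋆ₘ idm K) ∘ k K = idm K
}.

Record Comonad (A : Category) := {
  cm_functor :> Functor A A;
  cm_delta : forall X : A, Hom (cm_functor X) (cm_functor (cm_functor X));
  cm_eps : forall X : A, Hom (cm_functor X) X;
  cm_delta_natural : forall (X Y : A) (f : Hom X Y),
    cm_delta Y ∘ fmap cm_functor f
    = fmap cm_functor (fmap cm_functor f) ∘ cm_delta X;
  cm_eps_natural : forall (X Y : A) (f : Hom X Y),
    cm_eps Y ∘ fmap cm_functor f = f ∘ cm_eps X;
  cm_counit_l : forall X : A, cm_eps (cm_functor X) ∘ cm_delta X = idm (cm_functor X);
  cm_counit_r : forall X : A, fmap cm_functor (cm_eps X) ∘ cm_delta X = idm (cm_functor X);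
  cm_coassoc : forall X : A,
    cm_delta (cm_functor X) ∘ cm_delta X = fmap cm_functor (cm_delta X) ∘ cm_delta X
}.
Arguments cm_functor {A} c.
Arguments cm_delta {A} c X.
Arguments cm_eps {A} c X.
Arguments cm_delta_natural {A} c {X Y} f.
Arguments cm_eps_natural {A} c {X Y} f.
Arguments cm_counit_l {A} c X.
Arguments cm_counit_r {A} c X.
Arguments cm_coassoc {A} c X.

Record IsActegoryMorphism {C : SkewMonoidalCategory} {A B : SkewActegory C}
    (F : Functor A B) (gamma : forall (X : C) (P : A), Hom (X ⋆ F P) (F (X ⋆ P))) :
    Prop := {
  am_natural : forall (X X' : C) (P P' : A) (f : Hom X X') (g : Hom P P'),
    gamma X' P' ∘ (f ⋆ₘ fmap F g) = fmap F (f ⋆ₘ g) ∘ gamma X P;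
  am_assoc : forall (X Y : C) (P : A),
    fmap F (act_assoc X Y P) ∘ gamma (X ⊗ Y) P
    = gamma X (Y ⋆ P) ∘ (idm X ⋆ₘ gamma Y P) ∘ act_assoc X Y (F P);
  am_lunit : forall P : A, fmap F (act_lunit P) ∘ gamma munit P = act_lunit (F P)
}.

(* A comonad in the 2-category of left skew C-actegories.  The last two
   fields say that δ and ε are 2-cells (G, γ) ⇒ (G, γ)(G, γ) and
   (G, γ) ⇒ 1. *)
Record ActegoryComonad {C : SkewMonoidalCategory} (A : SkewActegory C) := {
  ac_comonad :> Comonad A;
  ac_gamma : forall (X : C) (P : A),
    Hom (X ⋆ ac_comonad P) (ac_comonad (X ⋆ P));
  ac_morphism : IsActegoryMorphism ac_comonad ac_gamma;
  ac_delta : forall (X : C) (P : A),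
    cm_delta ac_comonad (X ⋆ P) ∘ ac_gamma X P
    = fmap ac_comonad (ac_gamma X P) ∘ ac_gamma X (ac_comonad P)
      ∘ (idm X ⋆ₘ cm_delta ac_comonad P);
  ac_eps : forall (X : C) (P : A),
    cm_eps ac_comonad (X ⋆ P) ∘ ac_gamma X P = idm X ⋆ₘ cm_eps ac_comonad P
}.
Arguments ac_comonad {C A} a.
Arguments ac_gamma {C A} a X P.
Arguments ac_morphism {C A} a.
Arguments ac_delta {C A} a X P.
Arguments ac_eps {C A} a X P.

Record Coalgebra {A : Category} (G : Comonad A) := {
  coalg_obj : A;
  coalg_str : Hom coalg_obj (G coalg_obj);
  coalg_counit : cm_eps G coalg_obj ∘ coalg_str = idm coalg_obj;
  coalg_coassoc : cm_delta G coalg_obj ∘ coalg_str = fmap G coalg_str ∘ coalg_str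
}.
Arguments coalg_obj {A G} c.
Arguments coalg_str {A G} c.
Arguments coalg_counit {A G} c.
Arguments coalg_coassoc {A G} c.

Record CoalgebraHom {A : Category} {G : Comonad A} (P Q : Coalgebra G) := {
  coalg_mor : Hom (coalg_obj P) (coalg_obj Q);
  coalg_mor_comm : coalg_str Q ∘ coalg_mor = fmap G coalg_mor ∘ coalg_str P
}.
Arguments coalg_mor {A G P Q} c.
Arguments coalg_mor_comm {A G P Q} c.

Lemma coalg_hom_eq {A : Category} {G : Comonad A} {P Q : Coalgebra G}
  (f g : CoalgebraHom P Q) : coalg_mor f = coalg_mor g -> f = g.
Proof.
destruct f as [f Hf], g as [g Hg]; cbn; intros <-.
f_equal; apply proof_irrelevance.
Qed.

Definition coalg_id {A : Category} {G : Comonad A} (P : Coalgebra G) :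
  CoalgebraHom P P.
Proof.
refine {| coalg_mor := idm (coalg_obj P) |}.
abstract (now rewrite fmap_id, comp_id_l, comp_id_r).
Defined.

Definition coalg_comp {A : Category} {G : Comonad A} {P Q R : Coalgebra G}
  (g : CoalgebraHom Q R) (f : CoalgebraHom P Q) : CoalgebraHom P R.
Proof.
refine {| coalg_mor := coalg_mor g ∘ coalg_mor f |}.
abstract (now rewrite comp_assoc, coalg_mor_comm, <- comp_assoc, coalg_mor_comm,
  comp_assoc, fmap_comp).
Defined.

Definition EM_cat {A : Category} (G : Comonad A) : Category.
Proof.
refine {| Obj := Coalgebra G; Hom := @CoalgebraHom A G;
          idm := @coalg_id A G; comp := @coalg_comp A G |}.
- abstract (intros; apply coalg_hom_eq, comp_id_l).
- abstract (intros; apply coalg_hom_eq, comp_id_r).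
- abstract (intros; apply coalg_hom_eq, comp_assoc).
Defined.

Definition EM_forget {A : Category} (G : Comonad A) : Functor (EM_cat G) A.
Proof.
refine {| fobj := (fun P => coalg_obj P) : EM_cat G -> A;
          fmap := fun P Q f => coalg_mor f |}; abstract reflexivity.
Defined.

Definition cofree {A : Category} (G : Comonad A) (X : A) : Coalgebra G :=
  {| coalg_obj := G X; coalg_str := cm_delta G X;
     coalg_counit := cm_counit_l G X; coalg_coassoc := cm_coassoc G X |}.

Lemma bimap_id {C D E : Category} (F : Functor (prod_cat C D) E) (X : C) (Y : D) :
  bimap F (idm X) (idm Y) = idm (F (X, Y)).
Proof. exact (fmap_id F (X, Y)). Qed.

Lemma bimap_comp {C D E : Category} (F : Functor (prod_cat C D) E)
  {X X' X'' : C} {Y Y' Y'' : D} (f' : Hom X' X'') (f : Hom X X')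
  (g' : Hom Y' Y'') (g : Hom Y Y') :
  bimap F f' g' ∘ bimap F f g = bimap F (f' ∘ f) (g' ∘ g).
Proof.
exact (eq_sym (@fmap_comp _ _ F (X, Y) (X', Y') (X'', Y'') (f', g') (f, g))).
Qed.

Section EilenbergMooreActegory.
Context {C : SkewMonoidalCategory} {A : SkewActegory C} (G : ActegoryComonad A).

Definition EM_act_obj (X : C) (P : Coalgebra G) : Coalgebra G.
Proof.
refine {| coalg_obj := X ⋆ coalg_obj P;
          coalg_str := ac_gamma G X (coalg_obj P) ∘ (idm X ⋆ₘ coalg_str P) |}.
- abstract (rewrite comp_assoc, ac_eps, bimap_comp, coalg_counit, comp_id_l;
    apply bimap_id).
- abstract (rewrite comp_assoc, ac_delta, <- comp_assoc, bimap_comp,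
    coalg_coassoc, <- bimap_comp, fmap_comp, <- !comp_assoc;
    f_equal; rewrite !comp_assoc; f_equal;
    apply (am_natural _ _ (ac_morphism G))).
Defined.

Definition EM_act_mor {X Y : C} {P Q : Coalgebra G}
  (f : Hom X Y) (g : CoalgebraHom P Q) :
  CoalgebraHom (EM_act_obj X P) (EM_act_obj Y Q).
Proof.
refine {| coalg_mor := (f ⋆ₘ coalg_mor g)
            : Hom (coalg_obj (EM_act_obj X P)) (coalg_obj (EM_act_obj Y Q)) |}.
abstract (cbn; rewrite comp_assoc, <- (am_natural _ _ (ac_morphism G)),
  <- !comp_assoc, !bimap_comp, coalg_mor_comm, comp_id_l, comp_id_r; reflexivity).
Defined.

Definition EM_action : Functor (prod_cat C (EM_cat G)) (EM_cat G).
Proof.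
refine {| fobj := (fun p => EM_act_obj (fst p) (snd p))
            : prod_cat C (EM_cat G) -> EM_cat G;
          fmap := fun p q f => EM_act_mor (fst f) (snd f) |}.
- abstract (intros [X P]; apply coalg_hom_eq; apply bimap_id).
- abstract (intros p q r g f; apply coalg_hom_eq; symmetry; apply bimap_comp).
Defined.

Definition EM_act_assoc (X Y : C) (P : Coalgebra G) :
  CoalgebraHom (EM_act_obj (X ⊗ Y) P) (EM_act_obj X (EM_act_obj Y P)).
Proof.
refine {| coalg_mor := act_assoc X Y (coalg_obj P)
            : Hom (coalg_obj (EM_act_obj (X ⊗ Y) P))
                  (coalg_obj (EM_act_obj X (EM_act_obj Y P))) |}.
abstract (cbn; rewrite comp_assoc, (am_assoc _ _ (ac_morphism G)),
  <- !comp_assoc; f_equal;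
  rewrite <- bimap_id, act_assoc_natural, comp_assoc, bimap_comp, comp_id_l;
  reflexivity).
Defined.

Definition EM_act_lunit (P : Coalgebra G) : CoalgebraHom (EM_act_obj munit P) P.
Proof.
refine {| coalg_mor := act_lunit (coalg_obj P)
            : Hom (coalg_obj (EM_act_obj munit P)) (coalg_obj P) |}.
abstract (cbn; rewrite comp_assoc, (am_lunit _ _ (ac_morphism G)),
  act_lunit_natural; reflexivity).
Defined.

Definition EM_actegory : SkewActegory C.
Proof.
refine {| act_cat := EM_cat G; action := EM_action;
          act_assoc := EM_act_assoc; act_lunit := EM_act_lunit |}.
- abstract (intros; apply coalg_hom_eq, act_assoc_natural).
- abstract (intros; apply coalg_hom_eq, act_lunit_natural).
- abstract (intros; apply coalg_hom_eq, act_pentagon).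
- abstract (intros; apply coalg_hom_eq, act_lunit_assoc).
- abstract (intros; apply coalg_hom_eq, act_triangle).
Defined.

End EilenbergMooreActegory.

(* Main.v *)
Require Import Defs.

(** The component of the lifted family at a coalgebra [(A, a)] is the unique
    morphism [k'] with [γ ∘ k' = G k ∘ a], where [γ = γ_{TA,K}].  The
    equations about [k'] are proved by composing them on the left with invertible
    components of [γ] (or their images under [G] and [TA ⋆ -]) until [k'] can
    be traded for [G k ∘ a]; what remains is the image under [G] of the
    corresponding equation for [k], transported by the comonad and coalgebra
    laws:

    - [k'] is a morphism of coalgebras because [δ] is a 2-cell, [δ] is natural
      and [a] is coassociative ([lifted_k_coalgebra_hom]);
    - [k'] is natural because [k] and [γ] are ([lifted_k_natural]);
    - (W4) and (W5) for [k'] are [G] of (W4) and (W5) for [k], since [(G, γ)]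
      is compatible with [α] and [λ] ([lifted_W4], [lifted_W5]).  In (W4) one
      has to cancel [γ_{TA,TB⋆K} ∘ (1 ⋆ γ_{TB,K})], which is where the second
      invertibility hypothesis enters; in (W5) the equation
      [λ_{GK} = G λ_K ∘ γ_{I,K}] supplies [γ] without any cancellation.

    The axioms (W2) and (W3) involve the new unit only through [ε_K].  By
    naturality of [v] the counit moves past [v]; in (W2) this leaves the
    original axiom, and in (W3) it meets [k'], where
    [(1 ⋆ ε_K) ∘ k' = k] ([lifted_k_counit]) because [ε] is a 2-cell and [a] is
    counital.  Axiom (W1) and the naturality of [v] do not see the coalgebra
    structures at all.  As the forgetful functor from coalgebras is faithful,
    all of this can be checked in the base category. *)

Lemma invertible_cancel_l {C : Category} {X Y Z : C} {f : Hom Y Z}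
  (i : Invertible f) (g h : Hom X Y) : f ∘ g = f ∘ h -> g = h.
Proof.
intros E.
now rewrite <- (comp_id_l g), <- (comp_id_l h), <- (inv_l i), <- !comp_assoc, E.
Qed.

Definition fmap_invertible {C D : Category} (F : Functor C D) {X Y : C}
  {f : Hom X Y} (i : Invertible f) : Invertible (fmap F f).
Proof.
refine {| inv := fmap F (inv i) |}.
- now rewrite <- fmap_comp, inv_l, fmap_id.
- now rewrite <- fmap_comp, inv_r, fmap_id.
Defined.

Definition bimap_invertible_r {C D E : Category} (F : Functor (prod_cat C D) E)
  (X : C) {Y Y' : D} {g : Hom Y Y'} (i : Invertible g) :
  Invertible (bimap F (idm X) g).
Proof.
refine {| inv := bimap F (idm X) (inv i) |}.
- now rewrite bimap_comp, comp_id_l, inv_l, bimap_id.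
- now rewrite bimap_comp, comp_id_l, inv_r, bimap_id.
Defined.

Lemma gamma_natural_l {C : SkewMonoidalCategory} {A : SkewActegory C}
  (G : ActegoryComonad A) {X X' : C} (P : A) (f : Hom X X') :
  ac_gamma G X' P ∘ (f ⋆ₘ idm (G P)) = fmap G (f ⋆ₘ idm P) ∘ ac_gamma G X P.
Proof.
rewrite <- (fmap_id G P).
apply (am_natural _ _ (ac_morphism G)).
Qed.

Section LiftedWarping.
Context {C : SkewMonoidalCategory} {A : SkewActegory C}
  {T : Functor A C} {K : A}
  {v : forall X Y : A, Hom (T (T X ⋆ Y)) (T X ⊗ T Y)}
  {v0 : Hom (T K) munit}
  {k : forall X : A, Hom X (T X ⋆ K)}
  (warping : IsSkewLeftWarping A T K v v0 k)
  (G : ActegoryComonad A)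
  (gamma_K : forall X : A, Invertible (ac_gamma G (T X) K))
  (gamma_TK : forall X Y : A, Invertible (ac_gamma G (T X) (T Y ⋆ K))).

Lemma warp_v_natural_l {X X' : A} (Y : A) (f : Hom X X') :
  v X' Y ∘ fmap T (fmap T f ⋆ₘ idm Y) = (fmap T f ⊗ₘ idm (T Y)) ∘ v X Y.
Proof.
rewrite <- (fmap_id T Y).
apply (warp_v_natural _ _ _ _ _ _ warping).
Qed.

Lemma warp_v_natural_r (X : A) {Y Y' : A} (g : Hom Y Y') :
  v X Y' ∘ fmap T (idm (T X) ⋆ₘ g) = (idm (T X) ⊗ₘ fmap T g) ∘ v X Y.
Proof.
rewrite <- (fmap_id T X).
apply (warp_v_natural _ _ _ _ _ _ warping).
Qed.

Definition lifted_k (P : Coalgebra G) :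
  Hom (coalg_obj P) (T (coalg_obj P) ⋆ G K) :=
  inv (gamma_K (coalg_obj P)) ∘ fmap G (k (coalg_obj P)) ∘ coalg_str P.

(** This equation determines [lifted_k], since [γ] is invertible here; the
    equations for [lifted_k] are derived from it rather than from the formula
    with the inverse. *)
Lemma gamma_lifted_k (P : Coalgebra G) :
  ac_gamma G (T (coalg_obj P)) K ∘ lifted_k P
  = fmap G (k (coalg_obj P)) ∘ coalg_str P.
Proof.
unfold lifted_k.
now rewrite !comp_assoc, inv_r, comp_id_l.
Qed.

(** After composing with [G γ], the left side is [δ ∘ γ ∘ k'] because [δ] is a
    2-cell, and both sides reduce to [G (G k ∘ a) ∘ a]. *)
Lemma lifted_k_coalgebra_hom (P : Coalgebra G) :
  coalg_str (EM_act_obj G (T (coalg_obj P)) (cofree G K)) ∘ lifted_k P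
  = fmap G (lifted_k P) ∘ coalg_str P.
Proof.
apply (invertible_cancel_l (fmap_invertible G (gamma_K (coalg_obj P)))); cbn.
rewrite !comp_assoc, <- ac_delta, <- fmap_comp, gamma_lifted_k.
rewrite <- comp_assoc, gamma_lifted_k, comp_assoc, cm_delta_natural.
now rewrite <- comp_assoc, coalg_coassoc, comp_assoc, fmap_comp.
Qed.

Lemma lifted_k_natural {P Q : Coalgebra G} (f : CoalgebraHom P Q) :
  lifted_k Q ∘ coalg_mor f
  = (fmap T (coalg_mor f) ⋆ₘ idm (G K)) ∘ lifted_k P.
Proof.
apply (invertible_cancel_l (gamma_K (coalg_obj Q))).
rewrite !comp_assoc, gamma_lifted_k, gamma_natural_l.
rewrite <- !comp_assoc, gamma_lifted_k, coalg_mor_comm.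
rewrite !comp_assoc, <- !fmap_comp.
now rewrite (warp_k_natural _ _ _ _ _ _ warping).
Qed.

(** The counit recovers [k] from [k']: as [ε] is a 2-cell,
    [1 ⋆ ε_K = ε ∘ γ], and [ε ∘ G k ∘ a = k ∘ ε ∘ a = k]. *)
Lemma lifted_k_counit (P : Coalgebra G) :
  (idm (T (coalg_obj P)) ⋆ₘ cm_eps G K) ∘ lifted_k P = k (coalg_obj P).
Proof.
rewrite <- ac_eps, <- comp_assoc, gamma_lifted_k, comp_assoc, cm_eps_natural.
now rewrite <- comp_assoc, coalg_counit, comp_id_r.
Qed.

Lemma lifted_W2 (Y : A) :
  lunit (T Y) ∘ ((v0 ∘ fmap T (cm_eps G K)) ⊗ₘ idm (T Y)) ∘ v (G K) Y
  = fmap T (act_lunit Y) ∘ fmap T ((v0 ∘ fmap T (cm_eps G K)) ⋆ₘ idm Y).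
Proof.
(* [1 = 1 ∘ 1] splits [(v0 ∘ T ε) ⊗ 1] and [(v0 ∘ T ε) ⋆ 1] into two factors. *)
rewrite <- (comp_id_l (idm (T Y))), <- (comp_id_l (idm Y)), <- !bimap_comp.
rewrite fmap_comp, <- !comp_assoc, <- warp_v_natural_l, !comp_assoc.
now rewrite (warp_W2 _ _ _ _ _ _ warping).
Qed.

Lemma lifted_W3 (P : Coalgebra G) :
  (idm (T (coalg_obj P)) ⊗ₘ (v0 ∘ fmap T (cm_eps G K)))
    ∘ v (coalg_obj P) (G K) ∘ fmap T (lifted_k P)
  = runit (T (coalg_obj P)).
Proof.
rewrite <- (comp_id_l (idm (T (coalg_obj P)))), <- bimap_comp.
rewrite <- (comp_assoc (idm _ ⊗ₘ v0)), <- warp_v_natural_r.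
rewrite <- !comp_assoc, <- fmap_comp, lifted_k_counit, comp_assoc.
apply (warp_W3 _ _ _ _ _ _ warping).
Qed.

(** Composing with [γ ∘ (1 ⋆ γ)] makes the compatibility of [γ] with [α]
    applicable, which pulls [α ∘ (v ⋆ 1)] out as [G (α ∘ (v ⋆ 1))] in front of
    [G k]; this is [G] of (W4). *)
Lemma lifted_W4 (P Q : Coalgebra G) :
  act_assoc (T (coalg_obj P)) (T (coalg_obj Q)) (G K)
    ∘ (v (coalg_obj P) (coalg_obj Q) ⋆ₘ idm (G K))
    ∘ lifted_k (EM_act_obj G (T (coalg_obj P)) Q)
  = idm (T (coalg_obj P)) ⋆ₘ lifted_k Q.
Proof.
apply (invertible_cancel_l (bimap_invertible_r action (T (coalg_obj P))
  (gamma_K (coalg_obj Q)))).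
apply (invertible_cancel_l (gamma_TK (coalg_obj P) (coalg_obj Q))).
pose proof (gamma_lifted_k (EM_act_obj G (T (coalg_obj P)) Q)) as Hact.
cbn in Hact |- *.
rewrite bimap_comp, comp_id_l, gamma_lifted_k.
rewrite !comp_assoc, <- (am_assoc _ _ (ac_morphism G)).
rewrite <- (comp_assoc _ (ac_gamma G _ _)), gamma_natural_l, <- !comp_assoc.
rewrite Hact, !comp_assoc, <- !fmap_comp, (warp_W4 _ _ _ _ _ _ warping).
rewrite <- (am_natural _ _ (ac_morphism G)), <- comp_assoc, bimap_comp.
now rewrite comp_id_l.
Qed.

(** Since [λ_{GK} = G λ_K ∘ γ_{I,K}], the left side is [G] of the left side of
    (W5) followed by [G ε_K ∘ δ_K], and both factors are identities. *)
Lemma lifted_W5 :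
  act_lunit (G K) ∘ ((v0 ∘ fmap T (cm_eps G K)) ⋆ₘ idm (G K))
    ∘ lifted_k (cofree G K)
  = idm (G K).
Proof.
pose proof (gamma_lifted_k (cofree G K)) as Hcofree; cbn in Hcofree |- *.
rewrite <- (am_lunit _ _ (ac_morphism G)).
rewrite <- (comp_assoc _ (ac_gamma G _ _)), gamma_natural_l, <- !comp_assoc.
rewrite Hcofree, <- (comp_id_l (idm K)), <- bimap_comp.
rewrite !comp_assoc, <- !fmap_comp, <- !comp_assoc.
rewrite <- (warp_k_natural _ _ _ _ _ _ warping), !comp_assoc.
rewrite (warp_W5 _ _ _ _ _ _ warping), comp_id_l.
apply cm_counit_r.
Qed.

End LiftedWarping.

Theorem proposition7p2
    (C : SkewMonoidalCategory) (A : SkewActegory C)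
    (T : Functor A C) (K : A)
    (v : forall X Y : A, Hom (T (T X ⋆ Y)) (T X ⊗ T Y))
    (v0 : Hom (T K) munit)
    (k : forall X : A, Hom X (T X ⋆ K))
    (warping : IsSkewLeftWarping A T K v v0 k)
    (G : ActegoryComonad A)
    (gamma_K : forall X : A, Invertible (ac_gamma G (T X) K))
    (gamma_TK : forall X Y : A, Invertible (ac_gamma G (T X) (T Y ⋆ K))) :
  let U : Functor (EM_actegory G) A := EM_forget G in
  let K' : EM_actegory G := cofree G K in
  exists k' : forall P : EM_actegory G, Hom P (T (U P) ⋆ K'),
    (forall P : EM_actegory G,
       fmap U (k' P) = inv (gamma_K (U P)) ∘ fmap G (k (U P)) ∘ coalg_str P) /\
    IsSkewLeftWarping (EM_actegory G) (comp_functor T U) K'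
      (fun P Q => v (U P) (U Q)) (v0 ∘ fmap T (cm_eps G K)) k'.
Proof.
intros U K'.
exists (fun P : Coalgebra G =>
  {| coalg_mor := lifted_k (k := k) G gamma_K P
       : Hom (coalg_obj P)
             (coalg_obj (EM_act_obj G (T (coalg_obj P)) (cofree G K)));
     coalg_mor_comm := lifted_k_coalgebra_hom G gamma_K P |}).
split; [reflexivity | split].
- intros; apply (warp_v_natural _ _ _ _ _ _ warping).
- intros P Q f; apply coalg_hom_eq, (lifted_k_natural warping).
- intros; apply (warp_W1 _ _ _ _ _ _ warping).
- intros; apply (lifted_W2 warping).
- intros; apply (lifted_W3 warping).
- intros P Q; apply coalg_hom_eq, (lifted_W4 warping G gamma_K gamma_TK).
- apply coalg_hom_eq, (lifted_W5 warping).
Qed.
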